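(* For every non-zero $n\in\mathbb{N}\cup\{\omega\}$, the endomorphism monoid of the graph $n\mathbb{K}_\omega$ without loops possesses infinitely many Polish semigroup topologies.
   Context: $\mathbb{K}_\omega$ is the complete loopless graph on countably infinitely many vertices, and $n\mathbb{K}_\omega$ is the disjoint union of $n$ copies of $\mathbb{K}_\omega$. A semigroup topology on a semigroup is a topology for which multiplication is (jointly) continuous; Polish means separable and completely metrizable. *)

(* Defs.v *)
From HB Require Import structures.
From mathcomp Require Import all_boot all_order all_algebra.
From mathcomp Require Import all_classical reals topology.

Set Implicit Arguments.
Unset Strict Implicit.
Unset Printing Implicit Defensive.

Local Open Scope classical_set_scope.

Record graph := Graph {
  vertex : Type;
  adj : vertex -> vertex -> Prop;
  adj_sym : forall x y, adj x y -> adj y x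
}.

Definition complete_loopless (V : Type) : graph :=
  @Graph V (fun x y => x <> y) (fun x y xy yx => xy (esym yx)).

Section DisjointCopies.
Variables (I : Type) (G : graph).

Definition copies_adj (p q : I * vertex G) : Prop :=
  p.1 = q.1 /\ adj p.2 q.2.

Lemma copies_adj_sym p q : copies_adj p q -> copies_adj q p.
Proof. by move=> [pq1 pq2]; split; [rewrite pq1 | exact: adj_sym]. Qed.

Definition disjoint_copies : graph := Graph copies_adj_sym.

End DisjointCopies.

Definition K_omega : graph := complete_loopless nat.

Inductive nat_or_omega := Fin of nat | Omega.

Definition index_set (n : nat_or_omega) : Type :=
  match n with Fin k => 'I_k | Omega => nat end.

Definition nK_omega (n : nat_or_omega) : graph :=
  disjoint_copies (index_set n) K_omega.

Section EndomorphismMonoid.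
Variable G : graph.

Record End : Type := MkEnd {
  end_fun :> vertex G -> vertex G;
  end_adj : forall x y, adj x y -> adj (end_fun x) (end_fun y)
}.

Lemma End_ext (f g : End) : (f : _ -> _) = g -> f = g.
Proof.
case: f g => [f fP] [g gP] /= fg; subst g.
by congr MkEnd; exact: Prop_irrelevance.
Qed.

HB.instance Definition _ := gen_eqMixin End.
HB.instance Definition _ := gen_choiceMixin End.

Definition End_one : End := @MkEnd id (fun _ _ xy => xy).

Definition End_mul (f g : End) : End :=
  @MkEnd (f \o g) (fun _ _ xy => end_adj f (end_adj g xy)).

Lemma End_mulA : associative End_mul.
Proof. by move=> f g h; exact: End_ext. Qed.

Lemma End_mul1 : left_id End_one End_mul.
Proof. by move=> f; exact: End_ext. Qed.

Lemma End_1mul : right_id End_one End_mul.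
Proof. by move=> f; exact: End_ext. Qed.

HB.instance Definition _ := isMonoid.Build End End_mulA End_mul1 End_1mul.

End EndomorphismMonoid.

Definition separable (X : topologicalType) : Prop :=
  exists2 D : set X, countable D & dense D.

Definition complete_metric (R : realType) (M : metricType R) : Prop :=
  forall u : nat -> M, cauchy (u @ \oo) -> exists l : M, u @ \oo --> l.

(* [Metric.axioms_ R X] is the type of metric structures on the carrier of X,
   each of which carries its own metric topology. *)
Definition completely_metrizable (R : realType) (X : topologicalType) : Prop :=
  exists m : Metric.axioms_ R X,
    let M : metricType R := Metric.Pack m in
    @open M = @open X /\ complete_metric M.

Definition polish (R : realType) (X : topologicalType) : Prop :=
  separable X /\ completely_metrizable R X.

(* [Topological.axioms_ S] is the type of topological structures on the
   carrier of S. *)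
Definition semigroup_topology (S : semigroupType)
    (t : Topological.axioms_ S) : Prop :=
  let X : topologicalType := Topological.Pack t in
  continuous (fun p : X * X => ((p.1 : S) * (p.2 : S))%g : X).

(* A topology is recorded by its family of open sets: distinct terms of
   [Topological.axioms_ S] may describe the same topology, since they also
   contain choice and neighbourhood data. *)
Definition polish_semigroup_topologies (R : realType) (S : semigroupType) :
    set (set_system S) :=
  [set tau : set_system S | exists t : Topological.axioms_ S,
    [/\ @open (Topological.Pack t) = tau,
        polish R (Topological.Pack t) &
        semigroup_topology t] ].
Arguments polish_semigroup_topologies : clear implicits.

(* Main.v *)
(* An endomorphism f of n K_omega maps each copy i injectively into a copy, so
   it has a defect d_i(f), the number of points missing from the image of copy
   i inside its target copy.  For each k, observe the values of f, the
   preimages of points under each restriction of f, and, in each copy, the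
   first k missing points; let tau_k be the coarsest topology making these
   observations locally constant.
   - tau_k is Polish: the distance 1/(m + 1), m the first observation telling
     two maps apart, is complete, because a family of answers every finite part
     of which is realised by some endomorphism is realised by one.
   - Composition is continuous: if g maps copy i into copy i', the points of i'
     missing from f g are those missing from f and the images of those missing
     from g.  So d_i(f g) <= l forces d_i'(f) <= l and d_i(g) <= l; for l < k,
     both missing sets, and hence that of f g, are then locally constant.
   - The set { d_i <= k } is open in tau_l for l > k, but not in tau_k: moving
     far-away values of x |-> x + k up by one makes the defect k + 1 without
     changing any given finite set of observations. *)

Require Import Defs.
From HB Require Import structures.
From mathcomp Require Import all_boot all_order all_algebra.
From mathcomp Require Import all_classical reals topology.
From mathcomp Require Import zify.

Set Implicit Arguments.
Unset Strict Implicit.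
Unset Printing Implicit Defensive.

Import Order.TTheory GRing.Theory Num.Theory.

Local Open Scope classical_set_scope.

(** * The topology and metric of countably many discrete observations *)

Section Observations.
Variables (S : Type) (J C : countType) (o : J -> S -> C).

(** The initial topology of the maps [o j] into the discrete space [C]. *)
Definition observed_open : set_system S :=
  [set U | forall f, U f ->
     exists s : seq J, forall g, {in s, forall j, o j g = o j f} -> U g].

Definition separated_at (f g : S) (n : nat) : bool :=
  `[< exists2 j, pickle j = n & o j f <> o j g >].

Definition observation_dist (R : realType) (f g : S) : R :=
  if pselect (exists n, separated_at f g n) is left e
  then (ex_minn e).+1%:R^-1 else 0%R.

Lemma separated_dist (R : realType) (f g : S) (j : J) :
  o j f <> o j g -> ((pickle j).+1%:R^-1 <= observation_dist R f g)%R.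
Proof.
move=> fg; rewrite /observation_dist; case: pselect => [e|[]]; last first.
  by exists (pickle j); apply/asboolP; exists j.
case: ex_minnP => m _ /(_ (pickle j)) mj.
rewrite lef_pV2 ?posrE ?ltr0n// ler_nat ltnS; apply: mj.
by apply/asboolP; exists j.
Qed.

Lemma observation_dist_cases (R : realType) (f g : S) :
  (exists j, o j f <> o j g /\ observation_dist R f g = (pickle j).+1%:R^-1)%R \/
  ((forall j, o j f = o j g) /\ observation_dist R f g = 0%R).
Proof.
rewrite /observation_dist; case: pselect => [e|ne]; [left|right].
  by case: ex_minnP => m /asboolP[j <- jfg] _; exists j.
split=> // j; apply: contrapT => jfg; apply: ne.
by exists (pickle j); apply/asboolP; exists j.
Qed.


Lemma observation_dist_small (R : realType) (e : R) : (0 < e)%R ->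
  exists s : seq J, forall f g, {in s, forall j, o j f = o j g} ->
    (observation_dist R f g < e)%R.
Proof.
move=> e0; have [N Ne] : exists N, (N.+1%:R^-1 < e)%R.
  exists (Num.bound e^-1).
  rewrite invf_plt ?posrE ?ltr0n//; apply: lt_trans (_ : _ < _%:R)%R _.
    by apply: archi_boundP; rewrite invr_ge0 ltW.
  by rewrite ltr_nat.
(* Only the finitely many observations with code below [N] can force a distance above
   [1/(N + 1)]. *)
exists (pmap unpickle (iota 0 N)) => f g fg.
have [[j [jfg ->]]|[_ ->//]] := observation_dist_cases R f g.
apply: le_lt_trans Ne; rewrite lef_pV2 ?posrE ?ltr0n// ler_nat ltnS leqNgt.
apply/negP => jN; apply/jfg/fg; rewrite mem_pmap; apply/mapP.
by exists (pickle j); rewrite ?pickleK// mem_iota.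
Qed.

End Observations.

Section ObservationMetric.
Variables (R : realType) (S : choiceType) (J C : countType) (o : J -> S -> C).
Hypothesis o_sep : forall f g, (forall j, o j f = o j g) -> f = g.

Let dist := observation_dist o R.

Let distxx f : dist f f = 0%R.
Proof.
rewrite /dist.
by have [[j [/(_ erefl)[]]]|[_ ->]] := observation_dist_cases o R f f.
Qed.

Let dist_positivity f g : dist f g = 0%R -> f = g.
Proof.
rewrite /dist; have [[j [_ ->]]|[/o_sep->//]] := observation_dist_cases o R f g.
by move=> /eqP; rewrite invr_eq0 pnatr_eq0.
Qed.

Let dist_ge0 f g : (0 <= dist f g)%R.
Proof.
rewrite /dist; have [[j [_ ->]]|[_ ->//]] := observation_dist_cases o R f g.
by rewrite invr_ge0.
Qed.

Let dist_sym_le f g : (dist f g <= dist g f)%R.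
Proof.
rewrite {1}/dist; have [[j [jfg ->]]|[_ ->]] := observation_dist_cases o R f g.
  by apply: separated_dist => /esym.
exact: dist_ge0.
Qed.

Let dist_sym f g : dist f g = dist g f.
Proof. by apply: le_anti; rewrite !dist_sym_le. Qed.

Let dist_triangle g f h : (dist f h <= dist f g + dist g h)%R.
Proof.
rewrite {1}/dist; have [[j [jfh ->]]|[_ ->]] := observation_dist_cases o R f h;
  last by rewrite addr_ge0 ?dist_ge0.
(* At the first [j] telling [f] and [h] apart, [g] differs from one of them, so one summand alone is
   large enough. *)
have [jfg|jfg] := pselect (o j f = o j g).
  by rewrite ler_wpDl ?dist_ge0//; apply: separated_dist; rewrite -jfg.
by rewrite ler_wpDr ?dist_ge0//; apply: separated_dist.
Qed.

(** The [let] makes this alias of [S] depend on [R] and [o_sep], so that its metric can be inferred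
    from the type. *)
Definition observation_space : Type := let _ := (R, o_sep) in S.

HB.instance Definition _ := Choice.copy observation_space S.
HB.instance Definition _ := isMetric.Build R observation_space
  distxx dist_positivity dist_sym dist_triangle.

Local Notation M := observation_space.

Lemma nbhs_observation (f : M) (A : set M) :
  nbhs f A <->
  exists s : seq J, forall g : M, {in s, forall j, o j g = o j f} -> A g.
Proof.
split.
  move=> /nbhs_ballP[e /= e0 feA]; have [s sP] := observation_dist_small o e0.
  exists s => g gf; apply: feA; rewrite ballEmdist /=.
  by apply: sP => j js; rewrite gf.
move=> [s sA]; apply/nbhs_ballP.
exists (\max_(j <- s) pickle j).+1%:R^-1%R; first by rewrite /= invr_gt0 ltr0n.
move=> g; rewrite ballEmdist /= => fg; apply: sA => j js.
apply: contrapT => /nesym jfg; have := le_lt_trans (separated_dist R jfg) fg.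
rewrite ltf_pV2 ?posrE ?ltr0n// ltr_nat ltnS ltnNge => /negP; apply.
exact: leq_bigmax_seq.
Qed.

Lemma open_observation : @open M = observed_open o.
Proof.
apply/funext => U; apply/propext; rewrite openE; split=> UP f Uf.
  exact/nbhs_observation/UP.
exact/nbhs_observation/UP.
Qed.

(** One map is chosen for each realisable finite table of answers; there are countably many
    tables. *)
Lemma observation_separable : S -> separable M.
Proof.
move=> f0.
pose pickD (s : seq (J * C)) : M :=
  xget f0 [set f | {in s, forall jc, o jc.1 f = jc.2}].
exists (range pickD); first by apply: sub_countable (card_image_le _ _) _.
move=> U [f Uf]; rewrite open_observation => /(_ f Uf)[s sU].
exists (pickD [seq (j, o j f) | j <- s]); split; last by eexists.
apply: sU => j js.
rewrite /pickD; case: xgetP => [g -> /(_ (j, o j f))|/(_ f)]; first apply.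
  exact: map_f.
by case=> _ /mapP[i _ ->].
Qed.

(** Along a Cauchy sequence each observation stabilises, and any finitely many of the stable answers
    are realised by a late term. *)
Lemma observation_complete :
  (forall c : J -> C,
    (forall s : seq J, exists f, {in s, forall j, o j f = c j}) ->
    exists f, forall j, o j f = c j) ->
  complete_metric M.
Proof.
move=> realise u /cauchy_ballP u_cauchy.
have u_stable (j : J) : exists n, forall m, (n <= m)%N -> o j (u m) = o j (u n).
  have /u_cauchy : (0 < (pickle j).+1%:R^-1 :> R)%R by rewrite invr_gt0 ltr0n.
  case=> -[A B] /= [[a _ aA] [b _ bB]] AB.
  have jnm n m : (maxn a b <= n)%N -> (maxn a b <= m)%N -> o j (u n) = o j (u m).
    rewrite !geq_max => /andP[an _] /andP[_ bm].
    have := AB (u n, u m) (conj (aA n an) (bB m bm)).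
    rewrite /= ballEmdist /= => nm; apply: contrapT => nmE.
    by have := le_lt_trans (separated_dist R nmE) nm; rewrite ltxx.
  by exists (maxn a b) => m am; apply: jnm.
have [n nP] := choice u_stable.
have [|l lP] := realise (fun j => o j (u (n j))).
  move=> s; exists (u (\max_(j <- s) n j)) => j js; apply: nP.
  exact: leq_bigmax_seq.
exists l => A /nbhs_observation[s sA].
exists (\max_(j <- s) n j) => // m /= sm; apply: sA => j js.
by rewrite lP; apply: nP; apply: leq_trans sm; apply: leq_bigmax_seq.
Qed.

End ObservationMetric.

Lemma observed_polish_semigroup (R : realType) (S : semigroupType)
    (J C : countType) (o : J -> S -> C) :
  S ->
  (forall f g, (forall j, o j f = o j g) -> f = g) ->
  (forall c : J -> C,
    (forall s : seq J, exists f, {in s, forall j, o j f = c j}) ->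
    exists f, forall j, o j f = c j) ->
  (forall j f g, exists s : seq J, forall f' g',
    {in s, forall i, o i f' = o i f} -> {in s, forall i, o i g' = o i g} ->
    o j (f' * g')%g = o j (f * g)%g) ->
  polish_semigroup_topologies R S (observed_open o).
Proof.
move=> f0 sep realise o_mul; pose M : metricType R := observation_space R sep.
exists (Topological.class M); split; first exact: open_observation.
- split; first exact: observation_separable.
  by exists (Metric.class M); split=> //; exact: observation_complete.
- move=> [f g] A /(@nbhs_observation R S J C o sep)[s sA].
  have [t tP] := choice (fun j => o_mul j f g).
  pose B (h : M) : set M :=
    [set h' | {in flatten (map t s), forall j, o j h' = o j h}].
  have nB h : nbhs h (B h) by apply/nbhs_observation; exists (flatten (map t s)).
  exists (B f, B g); first by split; exact: nB.
  move=> [f' g'] [/= Bf Bg]; apply: sA => j js.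
  by apply: tP => i ij; [apply: Bf|apply: Bg];
    apply/flattenP; exists (t j) => //; exact: map_f.
Qed.

(** * The observations made of an endomorphism *)

Inductive observation (I : Type) :=
  | Value of I & nat
  | Preimage of I & nat
  | Gap of I & nat.

Section ObservationCountable.
Variable I : countType.

Definition observation_code (j : observation I) : 'I_3 * (I * nat) :=
  match j with
  | Value i x => (inord 0, (i, x))
  | Preimage i y => (inord 1, (i, y))
  | Gap i l => (inord 2, (i, l))
  end.

Definition observation_decode (c : 'I_3 * (I * nat)) : observation I :=
  match val c.1 with
  | 0 => Value c.2.1 c.2.2
  | 1 => Preimage c.2.1 c.2.2
  | _ => Gap c.2.1 c.2.2
  end.

Lemma observation_codeK : cancel observation_code observation_decode.
Proof. by case=> i n; rewrite /observation_decode /= inordK. Qed.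

HB.instance Definition _ :=
  Countable.copy (observation I) (can_type observation_codeK).

End ObservationCountable.

(** * Endomorphisms on one copy, and the points they miss *)

Section Endomorphisms.
Variable I : countType.

Local Notation V := (I * nat)%type.
Local Notation J := (observation I).
Local Notation E := (End (disjoint_copies I K_omega)).

Implicit Types (f g : E) (i : I) (x y z l k : nat) (j : J) (w : V).

Lemma End_copy f i x y : (f (i, x)).1 = (f (i, y)).1.
Proof.
have [->//|xy] := eqVneq x y.
by have [] // := @end_adj _ f (i, x) (i, y) (conj erefl (elimN eqP xy)).
Qed.

Lemma End_copy_inj f i x y : (f (i, x)).2 = (f (i, y)).2 -> x = y.
Proof.
move=> fxy; apply: contrapT => xy.
by have [_] := @end_adj _ f (i, x) (i, y) (conj erefl xy).
Qed.

(** Only the image of copy [i] counts: [y] may still be hit from another copy with the same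
    target. *)
Definition missing f i : pred nat := fun y => `[< forall x, (f (i, x)).2 <> y >].

Lemma missingP f i y : reflect (forall x, (f (i, x)).2 <> y) (missing f i y).
Proof. exact: asboolP. Qed.

Lemma missing_mul f g i y :
  missing (f * g)%g i y <->
  missing f (g (i, 0)).1 y \/
  exists2 x, missing g i x & (f ((g (i, 0)).1, x)).2 = y.
Proof.
set i' := (g (i, 0)).1.
have gE x : g (i, x) = (i', (g (i, x)).2).
  by rewrite [LHS]surjective_pairing (End_copy g i x 0).
split=> [/missingP fgy|].
  have [|] := boolP (missing f i' y); first by left.
  move/asboolPn => /existsNP[x' /contrapT fx']; right; exists x' => //.
  by apply/missingP => x gx; apply: (fgy x); rewrite /= gE gx.
case=> [/missingP fy|[x' /missingP gx' fx']]; apply/missingP => x /=; rewrite gE.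
  exact: fy.
(* [f] is injective on copy [i'], so the image of a point missed by [g] is not hit from
   elsewhere. *)
by rewrite -fx' => /End_copy_inj; exact: gx'.
Qed.

(** The bound on the defect [d_i(f)]; duplicate-free lists avoid a cardinal for a possibly infinite
    set. *)
Definition few_missing f i l : Prop :=
  forall t : seq nat, uniq t -> {in t, forall y, missing f i y} -> (size t <= l)%N.

Lemma few_missing_mul_l f g i l :
  few_missing (f * g)%g i l -> few_missing f (g (i, 0)).1 l.
Proof.
move=> few t ut tm; apply: few ut _ => y /tm my.
by apply/missing_mul; left.
Qed.

Lemma few_missing_mul_r f g i l :
  few_missing (f * g)%g i l -> few_missing g i l.
Proof.
move=> few t ut tm; rewrite -(size_map (fun x => (f ((g (i, 0)).1, x)).2)).
apply: few; first by rewrite map_inj_uniq// => x y; exact: End_copy_inj.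
by move=> _ /mapP[x /tm mx ->]; apply/missing_mul; right; exists x.
Qed.

(** The count is the rank of [y] among the missing points, starting from 0. *)
Lemma few_missing_count f i l y :
  few_missing f i l -> missing f i y -> (count (missing f i) (iota 0 y) < l)%N.
Proof.
move=> few my; have := few (seq.filter (missing f i) (iota 0 y.+1)).
rewrite filter_uniq ?iota_uniq// size_filter -addn1 iotaD count_cat /= my addn1.
by apply=> // z; rewrite mem_filter => /andP[].
Qed.

Lemma few_missingPn f i l :
  few_missing f i l \/
  exists2 y, missing f i y & count (missing f i) (iota 0 y) = l.
Proof.
have [?|/existsNP[t /not_implyP[ut /not_implyP[tm /negP]]]] :=
  pselect (few_missing f i l); first by left.
rewrite -ltnNge => lt; right.
have ex_l : exists N, (l < count (missing f i) (iota 0 N))%N.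
  exists (\max_(y <- t) y).+1; apply: leq_trans lt _.
  rewrite -size_filter uniq_leq_size// => y yt.
  by rewrite mem_filter tm// mem_iota ltnS; exact: leq_bigmax_seq.
(* The least initial segment with more than [l] missing points ends in the point of rank [l]. *)
case: (ex_minnP ex_l) => -[//|y] ly ymin.
have yl : (count (missing f i) (iota 0 y) <= l)%N.
  by rewrite leqNgt; apply/negP => /ymin; rewrite ltnn.
move: ly; rewrite -[in iota _ _](addn1 y) iotaD count_cat /= addn0.
case my: (missing f i y); last by rewrite addn0 ltnNge yl.
by rewrite addn1 ltnS => ly; exists y => //; apply/eqP; rewrite eqn_leq yl.
Qed.

(** * Answers as partial functions of the endomorphism *)

(* The answer to the observation j of f is w. [Gap i l] asks for the l-th point
   (counting from 0) missing from the image of the copy i, for l < k only. *)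
Definition answers k j f w : Prop :=
  match j with
  | Value i x => f (i, x) = w
  | Preimage i y => w.1 = i /\ (f w).2 = y
  | Gap i l => [/\ (l < k)%N, w.1 = i, missing f i w.2 &
                  count (missing f i) (iota 0 w.2) = l]
  end.

Lemma answers_inj k j f w w' : answers k j f w -> answers k j f w' -> w = w'.
Proof.
case: j => [i x|i y|i l] /=; first by move=> <-.
  case: w w' => [a x] [b z] [/= -> <-] [/= -> /End_copy_inj ->] //.
case: w w' => [a x] [b z] [_ /= -> mx <-] [_ /= -> mz xz]; congr (_, _).
(* The rank strictly increases past a missing point, hence determines it. *)
have count_lt u v : (u < v)%N -> missing f i u ->
    (count (missing f i) (iota 0 u) < count (missing f i) (iota 0 v))%N.
  move=> uv mu; rewrite -(subnKC uv) iotaD count_cat -[in iota 0 u.+1](addn1 u).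
  by rewrite iotaD count_cat /= mu addn0 addn1 ltn_addr.
by have [/count_lt/(_ mx)|/count_lt/(_ mz)|//] := ltngtP x z; rewrite xz ltnn.
Qed.

(** The points below [k] then fill all [k] observed gaps and hide every later missing point. *)
Lemma answers_initial_gap k i l f w : (forall y, (y < k)%N -> missing f i y) ->
  answers k (Gap i l) f w <-> (l < k)%N /\ w = (i, l).
Proof.
move=> mk; have gap_l : (l < k)%N -> answers k (Gap i l) f (i, l).
  move=> lk; split=> //=; first exact: mk.
  apply/eqP; rewrite -[X in _ == X](size_iota 0) -all_count; apply/allP => y.
  by rewrite mem_iota => /andP[_ yl]; apply: mk; apply: ltn_trans lk.
split=> [ans|[lk ->]]; last exact: gap_l.
have lk : (l < k)%N by case: ans.
by split=> //; exact: answers_inj ans (gap_l lk).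
Qed.

(** [None] is an answer too, so the absence of a preimage or of a gap is locally constant as
    well. *)
Definition observe k j f : option V :=
  if pselect (exists w, answers k j f w) is left e then Some (projT1 (cid e))
  else None.

Lemma observeP k j f w : observe k j f = Some w <-> answers k j f w.
Proof.
rewrite /observe; case: pselect => [e|ne]; last first.
  by split=> // fw; case: ne; exists w.
case: cid => /= w' fw'; split=> [[<-//]|fw].
by congr Some; exact: answers_inj fw' fw.
Qed.

Lemma eq_observe k j f k' j' f' :
  (forall w, answers k j f w <-> answers k' j' f' w) ->
  observe k j f = observe k' j' f'.
Proof.
move=> ff'; case E1: (observe k j f) => [w|].
  by apply/esym/observeP/ff'/observeP.
case E2: (observe k' j' f') => [w|//].
by move/observeP/ff'/observeP: E2; rewrite E1.
Qed.

Lemma observe_Value k i x f : observe k (Value i x) f = Some (f (i, x)).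
Proof. exact/observeP. Qed.

Lemma observe_Preimage_mul k i y f g :
  observe k (Preimage i y) (f * g)%g =
  obind (fun w => observe k (Preimage i w.2) g)
        (observe k (Preimage (g (i, 0)).1 y) f).
Proof.
case E1: (observe k (Preimage i y) (f * g)%g) => [[a x]|].
  move/observeP: E1 => [/= -> fgx].
  have /observeP -> : answers k (Preimage (g (i, 0)).1 y) f (g (i, x)).
    by split=> //; exact: End_copy.
  by apply/esym/observeP.
case E2: (observe _ (Preimage _ y) f) => [[a x']|//] /=.
case E3: (observe _ _ g) => [[b x]|//].
move/observeP: E2 => [/= aE fx']; move/observeP: E3 => [/= bE gx].
suff /observeP : answers k (Preimage i y) (f * g)%g (b, x) by rewrite E1.
split=> //=; rewrite (surjective_pairing (g (b, x))) gx bE (End_copy g i x 0).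
by rewrite -aE.
Qed.

Lemma missing_observe k f i y : missing f i y = (observe k (Preimage i y) f == None).
Proof.
apply/missingP/eqP => [fy|+ x fx].
  by case E: observe => [[a x]|//]; move/observeP: E => [/= -> /fy].
by have /observeP -> : answers k (Preimage i y) f (i, x) by [].
Qed.

Lemma eq_missing_answers k i l f f' w :
  missing f i =1 missing f' i ->
  answers k (Gap i l) f w <-> answers k (Gap i l) f' w.
Proof. by move=> ff' /=; rewrite ff' (eq_count ff'). Qed.

(* Whether w is the answer to j is decided by the observations [support j w],
   although the absence of any answer is not decided by finitely many. *)
Definition support j w : seq J :=
  match j with
  | Value i x => [:: Value i x]
  | Preimage i y => [:: Value w.1 w.2]
  | Gap i l => [seq Preimage i y | y <- iota 0 w.2.+1]
  end.

Lemma answers_support k j w f f' :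
  {in support j w, forall a, observe k a f = observe k a f'} ->
  answers k j f w -> answers k j f' w.
Proof.
case: j => [i x|i y|i l] ff'.
- have := ff' (Value i x).
  by rewrite mem_head !observe_Value => /(_ isT) [/= ->].
- case: w ff' => [a x] /= ff'; have := ff' (Value a x).
  by rewrite mem_head !observe_Value => /(_ isT) [<-].
- have mE y : (y <= w.2)%N -> missing f i y = missing f' i y.
    move=> yw; rewrite !(missing_observe k) (ff' (Preimage i y))//.
    by apply: (map_f (Preimage i)); rewrite mem_iota.
  rewrite /answers mE// => -[-> -> -> cw]; split=> //.
  rewrite -cw; apply: eq_in_count => y; rewrite mem_iota => /andP[_ yw].
  by rewrite mE// ltnW.
Qed.

(** Gaps are numbered from 0, so gap [l] exists exactly when more than [l] points are missing. *)
Lemma few_missing_observe k i l f : (l < k)%N ->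
  few_missing f i l <-> observe k (Gap i l) f = None.
Proof.
move=> lk; split=> [few|fN].
  case E: observe => [[a y]|//]; move/observeP: E => [_ /= _ my cy].
  by have := few_missing_count few my; rewrite cy ltnn.
have [//|[y my cy]] := few_missingPn f i l.
suff /observeP : answers k (Gap i l) f (i, y) by rewrite fN.
by [].
Qed.

Lemma few_missing_gap k i l f y : (l < k)%N ->
  few_missing f i l -> missing f i y ->
  exists2 m, (m <= l)%N & observe k (Gap i m) f = Some (i, y).
Proof.
move=> lk few my; have ml := few_missing_count few my.
exists (count (missing f i) (iota 0 y)); first exact: ltnW.
by apply/observeP; split=> //; apply: ltn_trans lk.
Qed.

(** The gaps below [l] list the missing points, and the absence of gap [l] certifies that the list
    is complete. *)
Lemma eq_few_missing k i l f f' : (l < k)%N -> few_missing f i l ->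
  (forall m, (m <= l)%N -> observe k (Gap i m) f' = observe k (Gap i m) f) ->
  missing f' i =1 missing f i.
Proof.
move=> lk few ff' y; apply/idP/idP => my.
  have few' : few_missing f' i l.
    by apply/(few_missing_observe i f' lk); rewrite ff'//; apply/few_missing_observe.
  have [m ml] := few_missing_gap lk few' my.
  by rewrite ff'// => /observeP[].
have [m ml] := few_missing_gap lk few my.
by rewrite -ff'// => /observeP[].
Qed.

(** * Separation and realisation of answers *)

Lemma observe_separates k f g :
  (forall j, observe k j f = observe k j g) -> f = g.
Proof.
move=> fg; apply/End_ext/funext => -[i x].
by have := fg (Value i x); rewrite !observe_Value => -[].
Qed.

Lemma observe_realised k (c : J -> option V) :
  (forall s : seq J, exists f, {in s, forall j, observe k j f = c j}) ->
  exists f, forall j, observe k j f = c j.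
Proof.
move=> approx.
have /choice[F FP] : forall v : V, exists w, c (Value v.1 v.2) = Some w.
  move=> v; have [f fc] := approx [:: Value v.1 v.2].
  by exists (f (v.1, v.2)); rewrite -fc ?mem_head// observe_Value.
have F_adj (v w : vertex (disjoint_copies I K_omega)) :
    adj v w -> adj (F v : vertex (disjoint_copies I K_omega)) (F w).
  have [f fc] := approx [:: Value v.1 v.2; Value w.1 w.2].
  have := fc (Value v.1 v.2); have := fc (Value w.1 w.2).
  rewrite !inE !eqxx orbT !FP !observe_Value => /(_ isT)[<-] /(_ isT)[<-] vw.
  by rewrite -!surjective_pairing; exact: (@end_adj _ f).
pose f0 : E := MkEnd F_adj; exists f0.
(* An answer in [c] passes to [f0] from an approximating map. Conversely an answer of [f0] passes to
   such a map, so it cannot contradict a [None] in [c]. *)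
have step j : (forall w a, a \in support j w -> observe k a f0 = c a) ->
    observe k j f0 = c j.
  move=> f0c; case E1: (c j) => [w|].
    have [f fc] := approx (j :: support j w); apply/observeP.
    apply: (@answers_support k j w f); last first.
      by apply/observeP; rewrite fc ?mem_head.
    by move=> a aw; rewrite (f0c w)// fc// inE aw orbT.
  case E2: (observe k j f0) => [w|//]; move/observeP: E2 => f0w.
  have [f fc] := approx (j :: support j w).
  suff /observeP : answers k j f w by rewrite fc ?mem_head// E1.
  apply: answers_support f0w => a aw.
  by rewrite (f0c w)// fc// inE aw orbT.
(* Values support preimages, which in turn support gaps. *)
have f0_Value i x : observe k (Value i x) f0 = c (Value i x).
  by rewrite observe_Value (FP (i, x)).
have f0_Preimage i y : observe k (Preimage i y) f0 = c (Preimage i y).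
  by apply: step => w a; rewrite inE => /eqP ->.
move=> [i x|i y|i l] //.
by apply: step => w a /mapP[y _ ->].
Qed.

(** * Joint continuity of composition *)

Lemma observe_mul_Value k i x f g :
  exists s : seq J, forall f' g',
    {in s, forall a, observe k a f' = observe k a f} ->
    {in s, forall a, observe k a g' = observe k a g} ->
    observe k (Value i x) (f' * g')%g = observe k (Value i x) (f * g)%g.
Proof.
exists [:: Value i x; Value (g (i, x)).1 (g (i, x)).2] => f' g' ff' gg'.
have := gg' (Value i x); rewrite mem_head !observe_Value => /(_ isT)[gE].
have := ff' (Value (g (i, x)).1 (g (i, x)).2).
rewrite !inE eqxx orbT !observe_Value -surjective_pairing => /(_ isT)[fE].
by rewrite /= gE fE.
Qed.

Lemma eq_copy k i f f' : observe k (Value i 0) f' = observe k (Value i 0) f ->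
  (f' (i, 0)).1 = (f (i, 0)).1.
Proof. by rewrite !observe_Value => -[->]. Qed.

Lemma observe_mul_Preimage k i y f g :
  exists s : seq J, forall f' g',
    {in s, forall a, observe k a f' = observe k a f} ->
    {in s, forall a, observe k a g' = observe k a g} ->
    observe k (Preimage i y) (f' * g')%g = observe k (Preimage i y) (f * g)%g.
Proof.
pose i' := (g (i, 0)).1.
(* Without a preimage under [f] on copy [i'], only the target copy of [g] has to be fixed. *)
pose s := if observe k (Preimage i' y) f is Some w then [:: Preimage i w.2]
          else [::].
exists [:: Value i 0, Preimage i' y & s] => f' g' ff' gg'.
rewrite !observe_Preimage_mul (eq_copy (gg' (Value i 0) _)) ?mem_head//.
rewrite -/i' (ff' (Preimage i' y)) ?inE ?eqxx ?orbT//.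
case E1: observe => [w|//] /=; apply: gg'.
by rewrite /s E1 !inE eqxx !orbT.
Qed.

Lemma observe_mul_many (s : seq J) k f g :
  (forall j, j \in s -> exists t : seq J, forall f' g',
    {in t, forall a, observe k a f' = observe k a f} ->
    {in t, forall a, observe k a g' = observe k a g} ->
    observe k j (f' * g')%g = observe k j (f * g)%g) ->
  exists t : seq J, forall f' g',
    {in t, forall a, observe k a f' = observe k a f} ->
    {in t, forall a, observe k a g' = observe k a g} ->
    {in s, forall j, observe k j (f' * g')%g = observe k j (f * g)%g}.
Proof.
elim: s => [|j s IH] js; first by exists [::].
have [|t tP] := IH; first by move=> i si; apply: js; rewrite inE si orbT.
have [t' t'P] := js j (mem_head _ _).
exists (t' ++ t) => f' g' ff' gg' i; rewrite inE => /predU1P[->|si].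
  by apply: t'P => a at'; [apply: ff'|apply: gg']; rewrite mem_cat at'.
by apply: tP si => a at'; [apply: ff'|apply: gg']; rewrite mem_cat at' orbT.
Qed.

Lemma observe_mul_Gap k i l f g :
  exists s : seq J, forall f' g',
    {in s, forall a, observe k a f' = observe k a f} ->
    {in s, forall a, observe k a g' = observe k a g} ->
    observe k (Gap i l) (f' * g')%g = observe k (Gap i l) (f * g)%g.
Proof.
have [lk|kl] := ltnP l k; last first.
  exists [::] => f' g' _ _; apply: eq_observe => w.
  by split=> -[+ _ _ _]; rewrite ltnNge kl.
case E1: (observe k (Gap i l) (f * g)%g) => [w|]; last first.
  have few := (few_missing_observe i (f * g)%g lk).2 E1.
  pose i' := (g (i, 0)).1.
  have few_f : few_missing f i' l := few_missing_mul_l few.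
  have few_g : few_missing g i l := few_missing_mul_r few.
  (* The finitely many points missed by [g]; the values of [f] there must be fixed too, as they are
     missed by the product. *)
  pose mg := [seq w.2 | w <- pmap (fun m => observe k (Gap i m) g) (iota 0 l.+1)].
  have mgP x : missing g i x -> x \in mg.
    move=> /(few_missing_gap lk few_g)[m ml gm].
    apply/mapP; exists (i, x) => //; rewrite mem_pmap -gm.
    by apply/mapP; exists m; rewrite // mem_iota.
  exists (Value i 0 :: [seq Value i' x | x <- mg] ++
    [seq Gap i m | m <- iota 0 l.+1] ++ [seq Gap i' m | m <- iota 0 l.+1]).
  move=> f' g' ff' gg'.
  have gE : (g' (i, 0)).1 = i' by apply/eq_copy/gg'/mem_head.
  have mfE : missing f' i' =1 missing f i'.
    apply: (eq_few_missing lk few_f) => m ml; apply: ff'.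
    by rewrite inE !mem_cat (map_f (Gap i')) ?orbT// mem_iota.
  have mgE : missing g' i =1 missing g i.
    apply: (eq_few_missing lk few_g) => m ml; apply: gg'.
    by rewrite inE !mem_cat (map_f (Gap i)) ?orbT// mem_iota.
  have fE x : missing g i x -> f' (i', x) = f (i', x).
    move=> /mgP gx; have := ff' (Value i' x); rewrite !observe_Value.
    by rewrite inE !mem_cat (map_f (Value i')) ?orbT// => /(_ isT)[].
  rewrite -E1; apply: eq_observe => w; apply: eq_missing_answers => y.
  apply/idP/idP => /missing_mul my; apply/missing_mul; move: my;
    rewrite gE -/i' mfE => -[|[x]]; first [by left|rewrite ?mgE => mx fx; right].
    by exists x; rewrite // -fE.
  by exists x; rewrite ?mgE// fE.
(* An existing gap [w] is decided by the preimages of the points up to [w.2], already handled. *)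
have [|s sP] := @observe_mul_many (support (Gap i l) w) k f g.
  by move=> _ /mapP[y _ ->]; exact: observe_mul_Preimage.
exists s => f' g' ff' gg'; apply/observeP.
apply: (@answers_support k (Gap i l) w (f * g)%g); last exact/observeP.
by move=> a /(sP f' g' ff' gg').
Qed.

Lemma End_polish_semigroup (R : realType) k :
  polish_semigroup_topologies R E (observed_open (observe k)).
Proof.
apply: observed_polish_semigroup; first exact: End_one.
- exact: observe_separates.
- exact: observe_realised.
- move=> [i x|i y|i l] f g.
  + exact: observe_mul_Value.
  + exact: observe_mul_Preimage.
  + exact: observe_mul_Gap.
Qed.

(** * Telling the topologies apart by the defect *)

Lemma few_missing_open i k l : (l < k)%N ->
  observed_open (observe k) [set f : E | few_missing f i l].
Proof.
move=> lk f /(few_missing_observe i f lk) fN; exists [:: Gap i l] => g gf.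
by apply/(few_missing_observe i g lk); rewrite gf ?mem_head.
Qed.

(* Misses exactly 0, ..., k - 1 and N + k. *)
Definition shift k N x := if (x < N)%N then x + k else (x + k).+1.

Lemma shift_inj k N : injective (shift k N).
Proof. by move=> x y; rewrite /shift; case: ltnP => xN; case: ltnP => yN; lia. Qed.

Definition along_copies (a : nat -> nat) (a_inj : injective a) : E :=
  @MkEnd (disjoint_copies I K_omega) (fun v => (v.1, a v.2))
    (fun v w vw => conj vw.1 (fun avw => vw.2 (a_inj _ _ avw))).

Lemma few_missing_not_open i k :
  ~ observed_open (observe k) [set f : E | few_missing f i k].
Proof.
pose f := along_copies (@addIn k).
have fm i' y : missing f i' y = (y < k)%N.
  apply/missingP/idP => [fy|yk x /=]; last by lia.
  by rewrite ltnNge; apply/negP => ky; apply: (fy (y - k)); rewrite /= subnK.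
move=> /(_ f)[|s sP].
  move=> t ut tm; rewrite -[leqRHS](size_iota 0).
  by apply: uniq_leq_size => // y /tm; rewrite fm mem_iota.
pose bound (j : J) :=
  match j with Value _ x => x | Preimage _ y => y | Gap _ _ => 0 end.
(* Beyond every point named in [s], so moving values from [N] on leaves those values and preimages
   unchanged. *)
pose N := (\max_(j <- s) bound j).+1.
have sN j : j \in s -> (bound j < N)%N.
  by move=> js; rewrite ltnS; exact: leq_bigmax_seq.
pose g := along_copies (@shift_inj k N).
have gm i' y : missing g i' y = (y < k)%N || (y == N + k).
  apply/missingP/idP => [gy|yk x /=]; last by rewrite /shift; case: ifP; lia.
  have [//|ky /=] := ltnP y k; apply: contrapT => yN.
  have := gy (if (y < N + k)%N then y - k else (y - k).-1).
  by rewrite /= /shift; case: (ltnP y (N + k)) => ?; case: ifP; lia.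
have : few_missing g i k.
  apply: sP => j /sN; case: j => [i' x|i' y|i' l] /= jN; apply: eq_observe => w /=.
  - by rewrite /shift jN.
  - by rewrite /shift; case: ifP => //; split; lia.
  (* Both maps miss all points below [k], so the extra missing point [N + k] is not among the
     observed gaps. *)
  - have gk y : (y < k)%N -> missing g i' y by rewrite gm => ->.
    have fk y : (y < k)%N -> missing f i' y by rewrite fm.
    apply: iff_trans (answers_initial_gap l w gk) _.
    exact: iff_sym (answers_initial_gap l w fk).
(* These are [k + 1] distinct points missed by [g]. *)
move=> /(_ (N + k :: iota 0 k)); rewrite /= size_iota iota_uniq mem_iota.
have -> : (N + k < k)%N = false by lia.
rewrite andbF => /(_ isT); rewrite ltnn => /(_ _)/notF; apply.
by move=> y; rewrite inE mem_iota gm orbC.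
Qed.

End Endomorphisms.

Lemma End_infinite (R : realType) (I : countType) (i : I) :
  infinite_set (polish_semigroup_topologies R (End (disjoint_copies I K_omega))).
Proof.
pose tau k := observed_open (@observe I k).
have tau_lt k l : (k < l)%N -> tau k <> tau l.
  move=> kl kltau; have := few_missing_open (i := i) kl; rewrite -/(tau l) -kltau.
  exact: few_missing_not_open.
have tau_inj : injective tau.
  by move=> k l; have [/tau_lt|/tau_lt/nesym|] := ltngtP k l.
apply/infiniteP; rewrite -(card_le_eql (inj_card_eq (in2W tau_inj))).
by apply: subset_card_le => _ [k _ <-]; exact: End_polish_semigroup.
Qed.

Theorem proposition5p2 (R : realType) (n : nat_or_omega) (hn : n <> Fin 0) :
  infinite_set (polish_semigroup_topologies R (End (nK_omega n))).
Proof.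
(* A non-zero [n] supplies a copy in which to measure the defect. *)
case: n hn => [[//|n] _|_].
  exact: (@End_infinite R 'I_n.+1 ord0).
exact: (@End_infinite R nat 0).
Qed.
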